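(* Let $G$ be a connected graph of order $n$. Then there exists a vertex $v\in V(G)$ such that $|EM(v)|=n-1$ if and only if there exists a vertex $v\in V(G)$ such that, for any $w\in V(G)$, there are no two distinct vertices $w_1,w_2\in N_G(w)$ such that $d_G(w_1,v)=d_G(w_2,v)=d_G(w,v)-1$.
   Context: Graphs are finite, undirected and simple; the order of a graph is its number of vertices; $N_G(w)$ is the set of neighbours of $w$ in $G$. $d_G(x,y)$ is the distance between $x$ and $y$ in $G$, and $G-e$ is the graph obtained from $G$ by deleting the edge $e$ (distances between different components are $\infty$). For a vertex $x$ of $G$, $EM(x)$ is the set of edges $e\in E(G)$ such that there exists a vertex $y\in V(G)$ with $d_G(x,y)\neq d_{G-e}(x,y)$. *)

(* Defs.v *)
From mathcomp Require Import all_boot.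

Set Implicit Arguments.
Unset Strict Implicit.
Unset Printing Implicit Defensive.

(* A simple graph on the vertex set V is given by its adjacency relation       *)
(* e : rel V, assumed symmetric and irreflexive where it matters; an edge is   *)
(* an unordered pair, i.e. a two-element set of vertices.                      *)
Section Graph.
Variables (V : finType) (e : rel V).

Definition neighbours (w : V) : {set V} := [set u | e w u].

Definition edges : {set {set V}} :=
  [set A : {set V} | [exists x, exists y, e x y && (A == [set x; y])]].

Definition connected_graph : Prop := forall x y : V, connect e x y.

Definition del_edge (A : {set V}) : rel V :=
  [rel x y | e x y && ([set x; y] != A)].

Definition has_walk (x y : V) (k : nat) : bool :=
  [exists p : k.-tuple V, path e x p && (last x p == y)].

Lemma connectPwalk x y : reflect (exists k, has_walk x y k) (connect e x y).
Proof.
apply: (iffP connectP) => [[p p_path ->]|[k /existsP[p /andP[p_path /eqP <-]]]].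
  by exists (size p); apply/existsP; exists (in_tuple p); rewrite p_path eqxx.
by exists p.
Qed.

(* None stands for an infinite distance. *)
Definition dist (x y : V) : option nat :=
  if connectPwalk x y is ReflectT xy then Some (ex_minn xy) else None.

Lemma dist_Some x y k :
  dist x y = Some k <->
  has_walk x y k /\ (forall j, has_walk x y j -> k <= j).
Proof.
rewrite /dist; case: connectPwalk => [xy|nxy]; last first.
  by split=> // -[xyk _]; case: nxy; exists k.
case: ex_minnP => m xym min_m; split=> [[<-]//|[xyk min_k]].
by congr Some; apply/eqP; rewrite eqn_leq min_m // min_k.
Qed.

Lemma dist_None x y : dist x y = None <-> ~~ connect e x y.
Proof. by rewrite /dist; case: connectPwalk. Qed.

End Graph.

Definition EM (V : finType) (e : rel V) (x : V) : {set {set V}} :=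
  [set A in edges e | [exists y, dist e x y != dist (del_edge e A) x y]].

(* Main.v *)
Require Import Defs.
From mathcomp Require Import all_boot.

Set Implicit Arguments.
Unset Strict Implicit.
Unset Printing Implicit Defensive.

(* Call a neighbour of w that is one step closer to v a parent of w. Deleting  *)
(* an edge changes some distance from v exactly when that edge joins a vertex  *)
(* w to its only parent: otherwise every vertex keeps a parent, and shortest   *)
(* walks from v are rebuilt by induction on the distance. Since such an edge   *)
(* determines its lower endpoint w, |EM(v)| is the number of vertices with     *)
(* exactly one parent. All vertices other than v have a parent and v has none, *)
(* so |EM(v)| = n - 1 if and only if no vertex has two parents.                *)

Lemma has_walkP (V : finType) (e : rel V) (x y : V) (k : nat) :
  reflect (exists p, [/\ path e x p, last x p = y & size p = k])
          (has_walk e x y k).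
Proof.
apply: (iffP existsP) => [[p /andP[p_path /eqP p_last]]|[p [p_path p_last <-]]].
  by exists p; rewrite size_tuple.
by exists (in_tuple p); rewrite p_path p_last eqxx.
Qed.

Lemma has_walk0 (V : finType) (e : rel V) (x y : V) :
  has_walk e x y 0 = (x == y).
Proof.
apply/has_walkP/eqP => [[p [_ <- /size0nil->]]//|->].
by exists [::].
Qed.

(** Walks are split at their last edge, because a parent is the penultimate vertex of a shortest
    walk from the root. *)
Lemma has_walkSP (V : finType) (e : rel V) (x y : V) (k : nat) :
  reflect (exists2 z, has_walk e x z k & e z y) (has_walk e x y k.+1).
Proof.
apply: (iffP (has_walkP _ _ _ _)) => [[p []]|[z /has_walkP[p [pp <- <-]] ezy]].
  case/lastP: p => [//|p z]; rewrite rcons_path last_rcons size_rcons.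
  move=> /andP[pp ez] <- [sz]; exists (last x p) => //.
  by apply/has_walkP; exists p.
by exists (rcons p y); rewrite rcons_path last_rcons size_rcons pp.
Qed.

Lemma has_walk_sub (V : finType) (e e' : rel V) (x y : V) (k : nat) :
  subrel e e' -> has_walk e x y k -> has_walk e' x y k.
Proof.
move=> see' /has_walkP[p [pp pl ps]]; apply/has_walkP; exists p; split=> //.
exact: sub_path pp.
Qed.

Lemma has_walkC (V : finType) (e : rel V) (x y : V) (k : nat) :
  symmetric e -> has_walk e x y k = has_walk e y x k.
Proof.
move=> e_sym; suff H a b : has_walk e a b k -> has_walk e b a k.
  by apply/idP/idP; apply: H.
move=> /has_walkP[p [pp <- <-]]; apply/has_walkP.
exists (rev (belast a p)); split; last by rewrite size_rev size_belast.
- by rewrite rev_path (eq_path (e' := e)) // => u w /=; rewrite e_sym.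
- by case: p {pp} => //= b' p; rewrite rev_cons last_rcons.
Qed.

Lemma dist_eq (V : finType) (e e' : rel V) (x y x' y' : V) :
  (forall k, has_walk e x y k = has_walk e' x' y' k) ->
  dist e x y = dist e' x' y'.
Proof.
move=> H; case E: (dist e' x' y') => [k|].
  case/dist_Some: E => xyk mink; apply/dist_Some; rewrite H; split=> // j.
  by rewrite H; apply: mink.
move/dist_None: E => nc; apply/dist_None; apply: contra nc.
by case/connectPwalk => k; rewrite H => xyk; apply/connectPwalk; exists k.
Qed.

Lemma distC (V : finType) (e : rel V) (x y : V) :
  symmetric e -> dist e x y = dist e y x.
Proof. by move=> e_sym; apply: dist_eq => k; apply: has_walkC. Qed.

Section Parents.
Variables (V : finType) (e : rel V).
Hypotheses (e_sym : symmetric e) (e_conn : connected_graph e).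
Variable v : V.

(** The default 0 never occurs: connectivity makes every distance finite, see [distE]. *)
Definition level (w : V) : nat := odflt 0 (dist e v w).

Definition parents (w : V) : {set V} := [set u | e u w & level w == (level u).+1].

Definition one_parent : {set V} := [set w | #|parents w| == 1].

Lemma distE w : dist e v w = Some (level w).
Proof.
rewrite /level; case E: (dist e v w) => //.
by move/dist_None: E; rewrite e_conn.
Qed.

Lemma level_walk w : has_walk e v w (level w).
Proof. by case/dist_Some: (distE w). Qed.

Lemma level_min w k : has_walk e v w k -> level w <= k.
Proof. by case/dist_Some: (distE w) => _; apply. Qed.

Lemma level_root : level v = 0.
Proof. by apply/eqP; rewrite -leqn0 level_min // has_walk0. Qed.

(** The penultimate vertex has level at most [k], and not less, or [w] would be closer to [v]. The
    walk may lie in a subgraph [e'] while levels are those of [e], so the lemma also applies after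
    an edge deletion. *)
Lemma walk_parent (e' : rel V) w k :
  subrel e' e -> level w = k.+1 -> has_walk e' v w k.+1 ->
  exists2 u, u \in parents w & e' u w.
Proof.
move=> se lw /has_walkSP[u vu uw]; exists u => //.
rewrite inE se //= lw eqSS eqn_leq.
rewrite (level_min (has_walk_sub se vu)) andbT -ltnS -lw.
apply: level_min; apply/has_walkSP; exists u; last exact: se.
exact: level_walk.
Qed.

Lemma parents_root : parents v = set0.
Proof. by apply/setP => u; rewrite !inE level_root andbF. Qed.

Lemma parents_neq0 w : w != v -> parents w != set0.
Proof.
move=> wv; have := level_walk w; case lw: (level w) => [|k].
  by rewrite has_walk0 eq_sym (negPf wv).
move=> /(walk_parent (fun _ _ => id) lw)[u uw _].
by apply/set0Pn; exists u.
Qed.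

Lemma one_parent_sub : one_parent \subset [set~ v].
Proof.
apply/subsetP => w; rewrite !inE; apply: contraTneq => ->.
by rewrite parents_root cards0.
Qed.

Lemma one_parentN (w u : V) :
  w \notin one_parent -> u \in parents w ->
  exists2 u', u' \in parents w & u' != u.
Proof.
rewrite inE => nw uw; have [/eqP E|] := eqVneq (parents w :\ u) set0.
  case/negP: nw; apply/cards1P; exists u; apply/eqP.
  by rewrite eqEsubset -setD_eq0 E sub1set.
by case/set0Pn=> u'; rewrite !inE => /andP[? ?]; exists u' => //; rewrite inE.
Qed.

Lemma sub_del_edge (A : {set V}) : subrel (del_edge e A) e.
Proof. by move=> x y /andP[]. Qed.

Lemma level_neq w u : u \in parents w -> u != w.
Proof. by rewrite inE => /andP[_]; apply: contraTneq => ->; rewrite neq_ltn leqnn. Qed.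

(** For [x] in [one_parent], [x |: parents x] is the edge from [x] to its only parent. If [A] is no
    such edge, every vertex other than [v] keeps a parent edge, and induction on the level
    applies. *)
Lemma del_edge_walk (A : {set V}) w :
  A \notin [set x |: parents x | x in one_parent] ->
  has_walk (del_edge e A) v w (level w).
Proof.
move=> nA; move lw: (level w) => k; elim: k w lw => [|k IH] w lw.
  by rewrite -lw; have := level_walk w; rewrite lw !has_walk0.
suff [u uw uA] : exists2 u, u \in parents w & [set u; w] != A.
  move: uw; rewrite inE lw eqSS => /andP[uw /eqP lu].
  by apply/has_walkSP; exists u; [exact: IH | apply/andP].
have /set0Pn[u uw] : parents w != set0.
  by apply: parents_neq0; apply/eqP => wv; rewrite wv level_root in lw.
have [uA|] := eqVneq [set u; w] A; last by exists u.
have [w1|w1] := boolP (w \in one_parent).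
  case/imsetP: nA; exists w => //; rewrite -uA setUC.
  move: w1; rewrite inE => /cards1P[x xE]; move: uw.
  by rewrite xE inE => /eqP->.
have [u' u'w u'u] := one_parentN w1 uw; exists u' => //.
rewrite -uA; apply: contraNneq u'u => E.
(* If [A] were also the edge to [u'], then [u'] would be [u] or [w]; a parent of [w] is not [w]. *)
have : u' \in [set u; w] by rewrite -E set21.
by rewrite !inE (negPf (level_neq u'w)) orbF.
Qed.

Lemma EM_one_parent : EM e v = [set x |: parents x | x in one_parent].
Proof.
apply/setP => A; apply/idP/idP => [|/imsetP[w w1 ->{A}]].
  rewrite inE => /andP[_ /existsP[y]]; apply: contraR => /del_edge_walk nA.
  rewrite distE eq_sym; apply/eqP/dist_Some; split=> // j.
  by move/(has_walk_sub (@sub_del_edge A))/level_min.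
move: w1; rewrite inE => /cards1P[u uE].
have : u \in parents w by rewrite uE set11.
rewrite inE => /andP[uw /eqP lw]; rewrite inE uE; apply/andP; split.
  rewrite inE; apply/existsP; exists w; apply/existsP; exists u.
  by rewrite e_sym uw eqxx.
(* The distance to [w] itself changes: a surviving walk of the old length would end with an edge
   from a parent, and the only such edge is deleted. *)
apply/existsP; exists w; rewrite distE eq_sym; apply/eqP => /dist_Some[].
rewrite lw => /(walk_parent (@sub_del_edge _) lw)[x].
by rewrite uE inE => /eqP-> /andP[_]; rewrite setUC eqxx.
Qed.

(** Distinct [w] and [w'] giving the same edge would be parents of each other, so each level would
    exceed the other by one. *)
Lemma card_EM : #|EM e v| = #|one_parent|.
Proof.
rewrite EM_one_parent card_in_imset // => w w' _ _ E.
apply: contraTeq isT => ww'.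
have : w \in w' |: parents w' by rewrite -E setU11.
have : w' \in w |: parents w by rewrite E setU11.
rewrite !inE eq_sym (negPf ww') /= => /andP[_ /eqP->] /andP[_ /eqP E'].
by have := leqnSn (level w').+1; rewrite -E' ltnn.
Qed.

Lemma card_EM_max :
  #|EM e v| = #|V| - 1 <-> (forall w, #|parents w| <= 1).
Proof.
rewrite card_EM subn1 -(cardsC1 v); split=> [cE w|H].
  (* [one_parent] lies in the complement of [v], so equal cardinality makes the two sets equal. *)
  have := subset_cardP cE one_parent_sub; move/(_ w); rewrite !inE => E.
  have [->|wv] := eqVneq w v; first by rewrite parents_root cards0.
  by move: E; rewrite wv => /eqP->.
apply: eq_card => w; rewrite !inE.
have [->|wv] := eqVneq w v; first by rewrite parents_root cards0.
by rewrite eqn_leq H card_gt0 parents_neq0.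
Qed.

Lemma mem_parents (u w : V) :
  (u \in parents w) =
  (u \in neighbours e w) && (omap succn (dist e u v) == dist e w v).
Proof.
rewrite !inE e_sym (distC u v e_sym) (distC w v e_sym) !distE.
by congr andb; apply/eqP/eqP => [->|[->]].
Qed.

End Parents.

Theorem theorem4p12 (V : finType) (e : rel V)
    (e_sym : symmetric e) (e_irr : irreflexive e)
    (e_conn : connected_graph e) (n : nat) (card_V : #|V| = n) :
  (exists v : V, #|EM e v| = n - 1) <->
  (exists v : V, forall w : V,
     ~ (exists w1 w2 : V,
          [/\ w1 \in neighbours e w, w2 \in neighbours e w, w1 <> w2,
              dist e w1 v = dist e w2 v
            & omap succn (dist e w2 v) = dist e w v])).
Proof.
(* The equivalence holds for each vertex separately, so the same [v] is the witness in both
   directions. *)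
split=> -[v Hv]; exists v.
  move=> w [w1 [w2 [n1 n2 w12 d12 d2]]]; apply: w12.
  move: Hv; rewrite -card_V => /(card_EM_max e_sym e_conn)/(_ w).
  move/card_le1_eqP; apply; rewrite (mem_parents e_sym e_conn).
    by rewrite n2 d2 eqxx.
  by rewrite n1 d12 d2 eqxx.
rewrite -card_V; apply/(card_EM_max e_sym e_conn) => w.
apply/card_le1_eqP => w1 w2; rewrite !(mem_parents e_sym e_conn).
move=> /andP[n1 /eqP d1] /andP[n2 /eqP d2].
apply/eqP; apply: contra_notT (Hv w) => /eqP w12.
exists w2, w1; split=> //.
by apply: (inj_omap succn_inj); rewrite d1.
Qed.
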